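(* Let $(c_k)_{k\ge 0}$ be a sequence in a field $\mathbb{K}$ such that $c_0\neq 0$; $c_{2m}=0$ for all integers $m\ge 1$; $H_n(c_{k+1})\neq 0$ for all $n=0,1,2,\ldots$; and $H_n(c_k)\ne 0$ for all $n=0,1,2,\ldots$ (so that the monic orthogonal polynomials with respect to $(c_k)$ exist). Let $P_n(y)$, $n\ge 0$, be the monic orthogonal polynomials with respect to $(c_k)_{k\ge0}$, and for $n\ge 1$ let $d_n$ be the coefficient of $y^{n-1}$ in $P_n(y)$. Then the polynomials $P_n(y)$ are completely determined by the sequence $(d_n)_{n\ge1}$ via $P_0(y)=1$, $P_1(y)=y+d_1$, and, for all $n\ge 1$, $$P_{n+1}(y)=\left(y+d_{n+1}-d_n\right)P_n(y)+d_n^2\,P_{n-1}(y).$$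
   Context: For a sequence $(c_k)_{k\ge 0}$, the Hankel determinants are $H_n(c_k):=\det(c_{i+j})_{0\le i,j\le n}$, and those of the shifted sequence $(c_{k+1})_{k\ge0}$ are $H_n(c_{k+1}):=\det(c_{i+j+1})_{0\le i,j\le n}$. Let $L$ be the linear functional on polynomials in $y$ with $L(y^k)=c_k$ for $k\ge0$. If $H_n(c_k)\ne 0$ for all $n\ge 0$, there is a unique sequence of monic polynomials $P_n(y)$ with $\deg P_n=n$ and nonzero $\zeta_n$ such that $L(P_m(y)P_n(y))=\zeta_n\delta_{m,n}$ for all $m,n\geq 0$; these are called the monic orthogonal polynomials with respect to $(c_k)$. *)

(* Defs.v *)
From HB Require Import structures.
From mathcomp Require Import all_boot all_order all_algebra.

Set Implicit Arguments.
Unset Strict Implicit.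
Unset Printing Implicit Defensive.

Import GRing.Theory.
Local Open Scope ring_scope.

(* The matrix has order n + 1: its indices run over 0, ..., n inclusive. *)
Definition hankel (K : fieldType) (c : nat -> K) (n : nat) : K :=
  \det (\matrix_(i < n.+1, j < n.+1) c (i + j)%N).

(* The linear functional L on {poly K} with L 'X^k = c k; see the instance
   and [moment_functionalXn] below. *)
Definition moment_functional (K : fieldType) (c : nat -> K) (p : {poly K})
  : K^o := \sum_(i < size p) p`_i * c i.

Lemma moment_functional_widen (K : fieldType) (c : nat -> K) (p : {poly K})
    (n : nat) :
  (size p <= n)%N -> moment_functional c p = \sum_(i < n) p`_i * c i.
Proof.
move=> le_pn; rewrite /moment_functional (big_ord_widen _ (fun i => p`_i * c i) le_pn).
rewrite [RHS](bigID (fun i : 'I_n => (i < size p)%N)) /=.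
rewrite [X in _ = _ + X]big1 ?addr0 // => i.
by rewrite -leqNgt => le_pi; rewrite nth_default ?mul0r.
Qed.

Lemma moment_functional_is_linear (K : fieldType) (c : nat -> K) :
  linear (moment_functional c).
Proof.
move=> a p q; pose n := maxn (size (a *: p + q)%R) (maxn (size p) (size q)).
have le_n : (size (a *: p + q)%R <= n)%N by rewrite leq_maxl.
have le_pn : (size p <= n)%N by rewrite /n !leq_max leqnn orbT.
have le_qn : (size q <= n)%N by rewrite /n !leq_max leqnn !orbT.
rewrite (moment_functional_widen c le_n) (moment_functional_widen c le_pn).
rewrite (moment_functional_widen c le_qn) scaler_sumr -big_split /=.
by apply: eq_bigr => i _; rewrite coefD coefZ mulrDl -mulrA.
Qed.

HB.instance Definition _ (K : fieldType) (c : nat -> K) :=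
  GRing.isLinear.Build K {poly K} K^o _ (moment_functional c)
    (@moment_functional_is_linear K c).

Lemma moment_functionalXn (K : fieldType) (c : nat -> K) (k : nat) :
  moment_functional c 'X^k = c k.
Proof.
rewrite /moment_functional size_polyXn big_ord_recr /= big1 => [|i _].
  by rewrite coefXn eqxx mul1r add0r.
by rewrite coefXn ltn_eqF ?mul0r.
Qed.

(* [size (P n) = n.+1] says that P n has degree n. *)
Definition monic_orthogonal (K : fieldType) (c : nat -> K)
    (P : nat -> {poly K}) : Prop :=
  (forall n, P n \is monic /\ size (P n) = n.+1) /\
  exists2 zeta : nat -> K,
    forall n, zeta n != 0 &
    forall m n, moment_functional c (P m * P n) = if m == n then zeta n else 0.

Definition recurrence (K : fieldType) (d : nat -> K) (Q : nat -> {poly K})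
  : Prop :=
  [/\ Q 0%N = 1,
      Q 1%N = 'X + (d 1%N)%:P &
      forall n, (1 <= n)%N ->
        Q n.+1 = ('X + (d n.+1 - d n)%:P) * Q n + (d n ^+ 2)%:P * Q n.-1].

(* Main.v *)
Require Import Defs.
From mathcomp Require Import all_boot all_order all_algebra.
From mathcomp Require Import ring.
Import GRing.Theory.
Local Open Scope ring_scope.

(* Write L for the functional and split each polynomial as p = e_p + o_p into
   its even and odd parts. Since the moments of positive even order vanish,
   L (e_p e_q) = c_0 p(0) q(0) and L (o_p o_q) = 0, whence
   L (e_p q) - L (p o_q) = c_0 p(0) q(0).
   Evaluating the left-hand side by orthogonality gives
   zeta_n = (-1)^n c_0 P_n(0)^2 for p = q = P_n, and
   d_n zeta_{n-1} = (-1)^(n-1) c_0 P_n(0) P_{n-1}(0) for p = P_n, q = P_{n-1}.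
   Hence d_n = P_n(0) / P_{n-1}(0) and zeta_n / zeta_{n-1} = - d_n^2, the
   coefficient of the three-term recurrence. Comparing P_n(y) with P_n(-y)
   instead would give the second identity only multiplied by 2, which is
   useless in characteristic 2. *)

(** Kept as a composition with ['X^2], the shape on which [moment_functional_even] evaluates the
    functional. *)
Definition even_part {R : nzRingType} (p : {poly R}) : {poly R} :=
  even_poly p \Po 'X^2.

Definition odd_part {R : nzRingType} (p : {poly R}) : {poly R} :=
  (odd_poly p \Po 'X^2) * 'X.

Lemma even_odd_part {R : nzRingType} (p : {poly R}) :
  even_part p + odd_part p = p.
Proof. exact: poly_even_odd. Qed.

Lemma coef_even_part {R : nzRingType} (p : {poly R}) (i : nat) :
  (even_part p)`_i = if odd i then 0 else p`_i.
Proof.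
rewrite coef_comp_poly_Xn // coef_even_poly dvdn2 divn2 if_neg.
by case: ifP => // ei; rewrite even_halfK ?ei.
Qed.

Lemma coef_odd_part {R : nzRingType} (p : {poly R}) (i : nat) :
  (odd_part p)`_i = if odd i then p`_i else 0.
Proof.
have := congr1 (fun q : {poly R} => q`_i) (even_odd_part p).
rewrite coefD coef_even_part; case: ifP => _; first by rewrite add0r.
by move/(canRL (addKr _)); rewrite addNr.
Qed.

Lemma size_even_part {R : nzRingType} (p : {poly R}) (n : nat) :
  (size p <= n)%N -> (size (even_part p) <= n)%N.
Proof.
move=> /leq_sizeP sp; apply/leq_sizeP => j lenj.
by rewrite coef_even_part sp //; case: ifP.
Qed.

Lemma size_odd_part {R : nzRingType} (p : {poly R}) (n : nat) :
  (size p <= n)%N -> (size (odd_part p) <= n)%N.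
Proof.
move=> /leq_sizeP sp; apply/leq_sizeP => j lenj.
by rewrite coef_odd_part sp //; case: ifP.
Qed.

Lemma size_leq_pred {R : nzRingType} (p : {poly R}) (n : nat) :
  (size p <= n.+1)%N -> p`_n = 0 -> (size p <= n)%N.
Proof.
move=> /leq_sizeP sp pn; apply/leq_sizeP => j.
by rewrite leq_eqVlt => /orP[/eqP <- //|]; apply: sp.
Qed.

Section Moments.

Context {K : fieldType} {c : nat -> K}.

Local Notation L := (moment_functional c).

Lemma moment_functionalD (p q : {poly K}) : L (p + q) = L p + L q :> K.
Proof. exact: linearD. Qed.

Lemma moment_functionalB (p q : {poly K}) : L (p - q) = L p - L q :> K.
Proof. exact: linearB. Qed.

Lemma moment_functionalCM (a : K) (p : {poly K}) : L (a%:P * p) = a * L p :> K.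
Proof. by rewrite mul_polyC linearZ. Qed.

(** A polynomial in ['X^2] meets only moments of even index, and among these only [c 0] survives. *)
Lemma moment_functional_even
    (hceven : forall m : nat, (1 <= m)%N -> c (2 * m)%N = 0) (a : {poly K}) :
  L (a \Po 'X^2) = c 0%N * a.[0].
Proof.
rewrite comp_polyE linear_sum /= horner_coef0.
under eq_bigr => i _.
  rewrite linearZ /= -exprM moment_functionalXn.
  over.
case sa: (size a) => [|n]; first by rewrite big_ord0 nth_default ?sa ?mulr0.
rewrite big_ord_recl muln0 big1 ?addr0 1?mulrC // => i _.
by rewrite hceven // scaler0.
Qed.

Lemma moment_parity_swap
    (hceven : forall m : nat, (1 <= m)%N -> c (2 * m)%N = 0) (p q : {poly K}) :
  L (q * even_part p) - L (p * odd_part q) = c 0%N * (p`_0 * q`_0) :> K.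
Proof.
rewrite -moment_functionalB.
(* The mixed product [even_part p * odd_part q] occurs in both terms and cancels. *)
have -> : q * even_part p - p * odd_part q
    = even_part p * even_part q - odd_part p * odd_part q.
  by rewrite -{1}(even_odd_part q) -{2}(even_odd_part p); ring.
(* Two odd parts multiply to a polynomial in ['X^2] divisible by ['X^2], so they do not affect the
   value at 0. *)
have -> : even_part p * even_part q - odd_part p * odd_part q
    = (even_poly p * even_poly q - odd_poly p * odd_poly q * 'X) \Po 'X^2.
  by rewrite /even_part /odd_part rmorphB !rmorphM /= comp_polyX; ring.
rewrite moment_functional_even // hornerD hornerN hornerMX mulr0 subr0 hornerM.
by rewrite !horner_coef0 !coef_even_poly.
Qed.

Context {P : nat -> {poly K}} {zeta : nat -> K}.
Hypothesis P_monic : forall n, P n \is monic.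
Hypothesis size_P : forall n, size (P n) = n.+1.
Hypothesis P_ortho :
  forall m n, L (P m * P n) = if m == n then zeta n else 0.

Lemma lead_orthogonal (n : nat) : (P n)`_n = 1.
Proof. by have /monicP := P_monic n; rewrite lead_coefE size_P. Qed.

Lemma moment_orthogonal_small (n : nat) (q : {poly K}) :
  (size q <= n)%N -> L (P n * q) = 0.
Proof.
(* The size bound is decoupled from [n] so that induction can lower it: subtracting a multiple of
   [P m] removes the top coefficient. *)
suff: forall m (r : {poly K}), (m <= n)%N -> (size r <= m)%N -> L (P n * r) = 0.
  by move=> /(_ n q (leqnn n)).
elim=> [r _|m IHm r ltmn sr].
  by rewrite size_poly_leq0 => /eqP ->; rewrite mulr0 linear0.
have -> : P n * r = P n * (r - (r`_m)%:P * P m) + (r`_m)%:P * (P n * P m).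
  by ring.
rewrite moment_functionalD moment_functionalCM P_ortho gtn_eqF // mulr0 addr0.
apply: IHm; first exact: ltnW.
apply: size_leq_pred; last first.
  by rewrite coefB coefCM lead_orthogonal mulr1 subrr.
rewrite (leq_trans (size_polyD _ _)) // size_polyN geq_max sr mul_polyC.
by rewrite (leq_trans (size_scale_leq _ _)) ?size_P.
Qed.

Lemma moment_orthogonal (n : nat) (q : {poly K}) :
  (size q <= n.+1)%N -> L (P n * q) = q`_n * zeta n :> K.
Proof.
move=> sq.
have -> : P n * q = P n * (q - (q`_n)%:P * P n) + (q`_n)%:P * (P n * P n).
  by ring.
rewrite moment_functionalD moment_functionalCM P_ortho eqxx.
rewrite moment_orthogonal_small ?add0r //.
apply: size_leq_pred; last first.
  by rewrite coefB coefCM lead_orthogonal mulr1 subrr.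
rewrite (leq_trans (size_polyD _ _)) // size_polyN geq_max sq mul_polyC.
by rewrite (leq_trans (size_scale_leq _ _)) ?size_P.
Qed.

Hypothesis zeta_neq0 : forall n, zeta n != 0.

(** Pairing with [P k] reads off the top coefficient up to the nonzero factor [zeta k], so the
    coefficients vanish from the top down. *)
Lemma orthogonal_eq0 (n : nat) (q : {poly K}) :
  (size q <= n)%N -> (forall k, (k < n)%N -> L (P k * q) = 0) -> q = 0.
Proof.
elim: n => [|n IHn] sq Lq; first by apply/eqP; rewrite -size_poly_leq0.
apply: IHn => [|k ltkn]; last exact/Lq/ltnW.
apply: size_leq_pred => //; apply/eqP.
have /eqP := Lq n (ltnSn n); rewrite moment_orthogonal // mulf_eq0.
by rewrite (negPf (zeta_neq0 n)) orbF.
Qed.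

Hypothesis hceven : forall m : nat, (1 <= m)%N -> c (2 * m)%N = 0.

(** The leading term of [P n] lies in the part of the same parity as [n]; hence exactly one term of
    the swap identity gives [zeta n], with sign (-1)^n. *)
Lemma orthogonal_sqnorm (n : nat) :
  zeta n = (-1) ^+ n * c 0%N * (P n)`_0 ^+ 2.
Proof.
have := moment_parity_swap hceven (P n) (P n).
rewrite !moment_orthogonal ?size_even_part ?size_odd_part ?size_P //.
rewrite coef_even_part coef_odd_part lead_orthogonal -signr_odd.
case: (odd n) => /= E; rewrite -mulrA -expr2 in E *.
  by rewrite expr1 mulN1r -E; ring.
by rewrite expr0 mul1r -E; ring.
Qed.

Lemma subleading_orthogonal (n : nat) :
  (P n.+1)`_n * (P n)`_0 = (P n.+1)`_0.
Proof.
have c0P0 : c 0%N * (P n)`_0 != 0.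
  have := zeta_neq0 n; rewrite orthogonal_sqnorm expr2 !mulf_eq0 !negb_or.
  by case/andP => /andP[_ ->] /andP[-> _].
have := moment_parity_swap hceven (P n.+1) (P n).
rewrite (moment_orthogonal_small n.+1) ?size_odd_part ?size_P // subr0.
have := orthogonal_sqnorm n; rewrite -signr_odd.
case on: (odd n) => /= Ez E; apply: (mulfI c0P0).
  (* For odd [n] the even part of [P n.+1] has degree n+1, too large for [moment_orthogonal]. It is
     replaced by [P n.+1], orthogonal to [P n], minus the odd part, whose degree is at most n. *)
  have so : (size (odd_part (P n.+1)) <= n.+1)%N.
    by rewrite size_leq_pred ?size_odd_part ?size_P // coef_odd_part /= on.
  have {}E : - ((P n.+1)`_n * zeta n) = c 0%N * ((P n.+1)`_0 * (P n)`_0).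
    rewrite -E; have /(canRL (addrK _)) -> := even_odd_part (P n.+1).
    rewrite mulrBr moment_functionalB P_ortho ltn_eqF // sub0r.
    by rewrite moment_orthogonal // coef_odd_part on.
  rewrite -[RHS]mulrA [(P n)`_0 * (P n.+1)`_0]mulrC -E Ez; ring.
have se : (size (even_part (P n.+1)) <= n.+1)%N.
  by rewrite size_leq_pred ?size_even_part ?size_P // coef_even_part /= on.
rewrite moment_orthogonal // coef_even_part on Ez in E.
rewrite -[RHS]mulrA [(P n)`_0 * (P n.+1)`_0]mulrC -E; ring.
Qed.

Lemma orthogonal_recurrence (n : nat) :
  P n.+2 = ('X + ((P n.+2)`_n.+1 - (P n.+1)`_n)%:P) * P n.+1
           + ((P n.+1)`_n ^+ 2)%:P * P n.
Proof.
have zetaS : zeta n.+1 = - (P n.+1)`_n ^+ 2 * zeta n.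
  by rewrite !orthogonal_sqnorm -subleading_orthogonal exprS; ring.
set a := _ - _; set b := _ ^+ 2 in zetaS *.
apply/eqP; rewrite -subr_eq0; apply/eqP.
(* Size bound: the coefficients of index n+2 cancel by monicity, those of index n+1 by the choice of
   [a]. *)
apply: (@orthogonal_eq0 n.+1) => [|k ltkn].
  have coefP m j : (m < j)%N -> (P m)`_j = 0.
    by move=> ltmj; rewrite nth_default ?size_P.
  apply/leq_sizeP => j; rewrite !(coefB, coefD, mulrDl, coefXM, coefCM).
  case: j => // j; rewrite ltnS /= leq_eqVlt => /orP[/eqP <-|ltnj].
    by rewrite lead_orthogonal (coefP n) // /a; ring.
  rewrite (coefP n) 1?(coefP n.+1 j.+1) ?(leqW ltnj) //.
  move: ltnj; rewrite leq_eqVlt => /orP[/eqP <-|ltnj].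
    by rewrite !lead_orthogonal; ring.
  by rewrite (coefP n.+2) // (coefP n.+1) //; ring.
(* Moving ['X] onto [P k] leaves a pairing of [P n.+1] with degree at most n+1. It is nonzero only
   for [k = n], where [zetaS] makes it cancel against the term in [b]. *)
have -> : P k * (P n.+2 - (('X + a%:P) * P n.+1 + b%:P * P n))
    = P k * P n.+2 - (P n.+1 * ('X * P k)) - a%:P * (P k * P n.+1)
      - b%:P * (P k * P n) by ring.
rewrite !moment_functionalB !moment_functionalCM !P_ortho.
rewrite (ltn_eqF ltkn) (ltn_eqF (ltnW ltkn : (k < n.+2)%N)).
rewrite moment_orthogonal; last first.
  by rewrite -commr_polyX size_mulX -?size_poly_gt0 size_P.
rewrite coefXM /= zetaS; move: ltkn; rewrite ltnS leq_eqVlt.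
case: eqVneq => [->|_] /= ltkn; first by rewrite lead_orthogonal; ring.
by rewrite nth_default ?size_P //; ring.
Qed.

End Moments.

Lemma recurrence_unique {K : fieldType} (d : nat -> K) (Q R : nat -> {poly K}) :
  recurrence d Q -> recurrence d R -> Q =1 R.
Proof.
move=> [Q0 Q1 QS] [R0 R1 RS] n.
suff: Q n = R n /\ Q n.+1 = R n.+1 by case.
elim: n => [|n [IHn IHn1]]; first by rewrite Q0 Q1 R0 R1.
by split=> //; rewrite QS // RS //= IHn IHn1.
Qed.

Theorem corollary12 (K : fieldType) (c : nat -> K)
    (hc0 : c 0%N != 0)
    (hceven : forall m : nat, (1 <= m)%N -> c (2 * m)%N = 0)
    (hH1 : forall n : nat, hankel (fun k : nat => c k.+1) n != 0)
    (hH0 : forall n : nat, hankel c n != 0)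
    (P : nat -> {poly K})
    (hP : monic_orthogonal c P)
    (d : nat -> K)
    (hd : forall n : nat, (1 <= n)%N -> d n = (P n)`_n.-1) :
  recurrence d P /\
  (forall Q : nat -> {poly K}, recurrence d Q -> forall n : nat, Q n = P n).
Proof.
have [Pms [zeta zeta_neq0 P_ortho]] := hP.
have P_monic n : P n \is monic by have [] := Pms n.
have size_P n : size (P n) = n.+1 by have [] := Pms n.
have recP : recurrence d P.
  (* The two initial clauses come from degree and monicity; orthogonality enters in the third. *)
  split=> [||[//|n] _].
  - have /monicP := P_monic 0%N; rewrite lead_coefE size_P /= => lead1.
    by rewrite [P 0%N]size1_polyC ?size_P // lead1.
  - apply/polyP => -[|[|i]]; rewrite coefD coefX coefC /=.
    + by rewrite add0r hd.
    + by rewrite addr0 (lead_orthogonal P_monic size_P).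
    + by rewrite addr0 nth_default ?size_P.
  - rewrite !hd //=.
    exact: (orthogonal_recurrence P_monic size_P P_ortho zeta_neq0 hceven).
by split=> // Q recQ; apply: recurrence_unique recQ recP.
Qed.
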